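(* Let $\epsilon>0$ and $\delta>0$ be real numbers, let $d\ge1$ be an integer and let $K\ge1$ be a real number. Then there exist constants $c>0$ and $q_0\in\mathbb{N}$, depending only on $\epsilon,\delta,d,K$, such that the following holds for every prime power $q\ge q_0$. Let $\mathbb{F}_q$ be the finite field with $q$ elements and let $A\subset\mathbb{F}_q$ satisfy (1) $|A||AA|\ge K^{-1}q^{\frac32+\epsilon}$, and (2) $|AA|\le K q^{1-\delta}$. Let $G\subset\mathbb{F}_q$ be any $d$-dimensional generalized geometric progression with $K^{-1}|AA|\le|G|\le K|AA|$. Then $$|(AA+1)\setminus G|\ \ge\ c\,q^{\delta}.$$
   Context: For a set $A\subset\mathbb{F}_q$, $|A|$ denotes its number of elements, $AA=\{ab: a\in A,\ b\in A\}$, and $AA+1=\{x+1: x\in AA\}$. Given integers $r_0,r_1,\dots,r_d$ (generators) and integers $l_1,\dots,l_d>2$, the $d$-dimensional generalized arithmetic progression they define is $$R=R(r_0,\dots,r_d,l_1,\dots,l_d)=\{r_0+x_1r_1+\dots+x_dr_d : x_j\in\mathbb{Z},\ 0\le x_j<l_j,\ j=1,\dots,d\}.$$ A $d$-dimensional generalized geometric progression in $\mathbb{F}_q$ is a set of the form $G=G(g_0,R)=\{g_0^{r}: r\in R\}$, where $g_0\in\mathbb{F}_q^*=\mathbb{F}_q\setminus\{0\}$ and $R$ is a $d$-dimensional generalized arithmetic progression of integers. A progression is called non-degenerate if its dimension $d$ stays bounded (is like a constant) as the size of the progression grows; in the claim this is expressed by fixing $d$ first and letting the constants depend on it. *)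

(* Defs.v *)
From HB Require Import structures.
From mathcomp Require Import all_boot all_order all_algebra.
From mathcomp Require Import all_classical all_reals all_analysis.

Set Implicit Arguments.
Unset Strict Implicit.
Unset Printing Implicit Defensive.

Import Order.TTheory GRing.Theory Num.Theory.
Local Open Scope ring_scope.

Definition arith_prog (d : nat) (r0 : int) (r l : 'I_d -> int) : set int :=
  [set n | exists x : 'I_d -> int,
     (forall j, 0 <= x j < l j) /\ n = r0 + \sum_(j < d) x j * r j]%classic.

(* The progression need not be proper: the representations of its elements may
   coincide, and generators may vanish. *)
Definition is_arith_prog (d : nat) (P : set int) : Prop :=
  exists (r0 : int) (r l : 'I_d -> int),
    (forall j, 2 < l j) /\ P = arith_prog r0 r l.

(* The exponents n are (possibly negative) integers: [g0 ^ n] is [exprz]. *)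
Definition is_geom_prog (F : finFieldType) (d : nat) (G : {set F}) : Prop :=
  exists (g0 : F) (P : set int),
    [/\ g0 != 0, is_arith_prog d P &
        [set` G]%classic = [set g0 ^ n | n in P]%classic].

Definition prodset (F : finFieldType) (A : {set F}) : {set F} :=
  [set a * b | a in A, b in A]%SET.

Definition succset (F : finFieldType) (B : {set F}) : {set F} :=
  [set x + 1 | x in B]%SET.

(* Main.v *)
Require Import Defs.
From HB Require Import structures.
From mathcomp Require Import all_boot all_order all_algebra.
From mathcomp Require Import all_classical all_reals all_analysis.
From mathcomp Require Import ring lra zify.
Import Order.TTheory GRing.Theory Num.Theory.
Local Open Scope ring_scope.

(** A geometric progression G has small multiplicative doubling: GG is covered
    by 2^d translates of G. If AA + 1 were almost contained in G, this would
    produce too many incidences between points and lines of the plane F x F.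

    For g in G and a nonzero a in A consider the line y = (ga)x + g. At x = b in
    A it takes the value g(ab + 1), which lies in GG whenever ab + 1 is in G, and
    for fixed a this fails for at most |D| values of b, where D = (AA + 1) \ G.
    So if |D| <= |A|/2, then about |G||A| lines each contain at least |A|/2
    points of the grid P = A x GG. An average line contains |P|/q points, which
    is at most |A|/4 because |GG| <= 2^d |G| is much smaller than q. Hence all
    these lines exceed the average by at least |A|/4.

    Such an excess cannot occur often: two points lie on at most one common
    line, so summing over all q^2 lines the squared deviation of the number of
    points from |P|/q gives at most q|P| ([rich_lines_bound]). Comparing,
    |G||A|^3 is at most a constant times q|A||GG|, so |A|^2 is at most a constant
    times q ([succset_prodset_escape]).

    On the other hand, dividing the lower bound for |A||AA| by the upper bound
    for |AA| gives |A| >= q^(1/2 + eps + delta) / K^2, whose square is far larger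
    than q. Therefore |D| > |A|/2, and this is at least q^delta / (2 K^2). *)

(** * Points and lines in the plane over a finite field *)

(** The pair [(m, k)] stands for the line y = mx + k; vertical lines are left
    out. *)
Definition incident (F : finFieldType) (l p : F * F) : bool :=
  p.2 == l.1 * p.1 + l.2.

Definition richness (F : finFieldType) (P : {set F * F}) (l : F * F) : nat :=
  #|[set p in P | incident F l p]|.

Lemma richnessE (F : finFieldType) (P : {set F * F}) (l : F * F) :
  richness F P l = (\sum_(p in P) incident F l p)%N.
Proof.
by rewrite /richness -sum1dep_card big_mkcondr; apply: eq_bigr => p _; case: incident.
Qed.

(** Through a given point there is exactly one line of each slope. *)
Lemma sum_incident (F : finFieldType) (p : F * F) :
  (\sum_l incident F l p)%N = #|F|.
Proof.
rewrite -(pair_bigA _ (fun m k => incident F (m, k) p : nat)) /=.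
rewrite -sum1_card; apply: eq_bigr => m _.
rewrite (bigD1 (p.2 - m * p.1)) //= {1}/incident /= addrC subrK eqxx big1 // => k.
rewrite /incident /= => /negPf nk; case: eqP => // e; move: nk.
by rewrite e addrAC subrr add0r eqxx.
Qed.

Lemma sum_incident2 (F : finFieldType) (p p' : F * F) : p != p' ->
  (\sum_l incident F l p * incident F l p' <= 1)%N.
Proof.
move=> npp'.
have -> : (\sum_l incident F l p * incident F l p')%N
    = #|[set l | incident F l p && incident F l p']|.
  rewrite -sum1dep_card [RHS]big_mkcond /=; apply: eq_bigr => l _.
  by case: incident; case: incident.
apply/card_le1_eqP => -[m k] [m' k'].
rewrite !inE /incident /=.
move=> /andP[/eqP e1 /eqP e2] /andP[/eqP e3 /eqP e4].
have e : (m - m') * (p.1 - p'.1) = 0.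
  by transitivity ((m * p.1 + k) - (m * p'.1 + k)
       - (m' * p.1 + k') + (m' * p'.1 + k')); [ring | rewrite -e1 -e2 -e3 -e4; ring].
have mm : m = m'.
  move/eqP: e; rewrite mulf_eq0 !subr_eq0 => /orP[/eqP//|/eqP xx].
  by case/eqP: npp'; apply: injective_projections; rewrite // e1 e2 xx.
by rewrite mm; congr (_, _); apply: (addrI (m' * p.1)); rewrite -e3 -mm -e1.
Qed.

Lemma sum_richness (F : finFieldType) (P : {set F * F}) :
  (\sum_l richness F P l)%N = (#|F| * #|P|)%N.
Proof.
under eq_bigr do rewrite richnessE.
rewrite exchange_big /=; under eq_bigr do rewrite sum_incident.
by rewrite sum_nat_const mulnC.
Qed.

(** The left side counts the triples of two points of P and a line through both.
    Distinct points contribute at most one line, and each of the |P| diagonal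
    pairs contributes q. *)
Lemma sum_richness_sqr (F : finFieldType) (P : {set F * F}) :
  (\sum_l richness F P l ^ 2 <= #|P| ^ 2 + #|F| * #|P|)%N.
Proof.
have -> : (\sum_l richness F P l ^ 2 =
    \sum_(p in P) \sum_(p' in P) \sum_l incident F l p * incident F l p')%N.
  under eq_bigr do rewrite richnessE expnS expn1 big_distrlr /=.
  by rewrite exchange_big; apply: eq_bigr => p _; rewrite exchange_big.
rewrite -mulnn -mulnDl mulnC -sum_nat_const.
apply: leq_sum => p pP; rewrite (bigD1 p) //= addnC; apply: leq_add.
  rewrite -sum1_card big_mkcondr /=.
  by apply: leq_sum => p' _; case: ifP => // n; apply: sum_incident2; rewrite eq_sym.
rewrite -(sum_incident F p) leq_sum // => l _.
by case: incident.
Qed.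

(** Chebyshev's inequality for the number of points of P on a random line. The
    mean over all lines is |P|/q, and the first two moments show that the
    squared deviations add up to at most q|P|. *)
Lemma rich_lines_bound (R : realFieldType) (F : finFieldType) (P L : {set F * F}) (t : R) :
  0 <= t ->
  (forall l, l \in L -> #|P|%:R / #|F|%:R + t <= (richness F P l)%:R) ->
  #|L|%:R * t ^+ 2 <= #|F|%:R * #|P|%:R.
Proof.
move=> t0 HL.
set q : R := #|F|%:R; set N : R := #|P|%:R.
have q0 : q != 0 by rewrite pnatr_eq0 -lt0n; apply/card_gt0P; exists 0.
pose dev l := ((richness F P l)%:R - N / q) ^+ 2.
apply: (@le_trans _ _ (\sum_l dev l)).
  rewrite mulr_natl -sumr_const.
  rewrite [leRHS](bigID (mem L)) /= -[leLHS]addr0; apply: lerD.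
    apply: ler_sum => l /HL Hl; rewrite ler_sqr ?nnegrE //; lra.
  by apply: sumr_ge0 => l _; apply: sqr_ge0.
have -> : \sum_l dev l = \sum_l (richness F P l ^ 2)%N%:R
   - 2 * (N / q) * \sum_l (richness F P l)%:R + q ^+ 2 * (N / q) ^+ 2.
  have <- : \sum_(l : F * F) (N / q) ^+ 2 = q ^+ 2 * (N / q) ^+ 2.
    by rewrite sumr_const card_prod -[LHS]mulr_natl natrM.
  rewrite mulr_sumr -sumrB -big_split /=.
  by apply: eq_bigr => l _; rewrite /dev natrX; ring.
rewrite -!natr_sum sum_richness.
have := sum_richness_sqr F P; rewrite -(ler_nat R).
rewrite natrD natrX !natrM -/q -/N.
have -> : 2 * (N / q) * (q * N) = 2 * N ^+ 2 by field.
have -> : q ^+ 2 * (N / q) ^+ 2 = N ^+ 2 by field.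
lra.
Qed.

(** * Multiplicative doubling of a geometric progression *)

(** A sum x + y of two points of the box of exponents, which has sides l_j, lies
    in the box translated by one of its 2^d corners: coordinatewise, subtract
    l_j - 1 exactly when x_j + y_j >= l_j. Hence GG is a union of 2^d
    multiplicative translates of G, even if the progression is not proper. *)
Lemma geom_prog_small_doubling (F : finFieldType) (d : nat) (G : {set F}) : is_geom_prog d G ->
  [/\ 0 \notin G, (0 < #|G|)%N & (#|prodset G| <= 2 ^ d * #|G|)%N].
Proof.
move=> [g0 [P [g0n0 [r0 [r [l [hl ->]]]] eG]]].
pose elt (x : 'I_d -> int) := g0 ^ (r0 + \sum_(j < d) x j * r j).
have GP g : g \in G <-> exists2 x, (forall j, 0 <= x j < l j) & g = elt x.
  have -> : (g \in G) = (g \in [set` G]%classic) :> Prop by rewrite inE.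
  rewrite eG inE; split => [[n [x [hx ->]] <-]|[x hx ->]]; first by exists x.
  by exists (r0 + \sum_(j < d) x j * r j) => //; exists x.
split.
- by apply/negP => /GP [x _] /eqP; rewrite eq_sym expfz_eq0 (negPf g0n0) andbF.
- apply/card_gt0P; exists (elt (fun=> 0)); apply/GP; exists (fun=> 0) => // j.
  by rewrite lexx (lt_trans _ (hl j)).
pose corner (e : {ffun 'I_d -> bool}) := elt (fun j => if e j then l j - 1 else 0).
have sub : prodset G \subset [set h * g | h in [set corner e | e in predT], g in G]%SET.
  apply/fintype.subsetP => z /imset2P [a b /GP [x hx ->] /GP [y hy ->] ->].
  pose e : {ffun 'I_d -> bool} := [ffun j => l j <= x j + y j].
  pose w j := x j + y j - (if e j then l j - 1 else 0).
  apply/imset2P; exists (corner e) (elt w).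
  - by apply/imsetP; exists e.
  - apply/GP; exists w => // j; rewrite /w /e ffunE.
    move: (hx j) (hy j) (hl j).
    by case: (leP (l j) (x j + y j)) => ? /andP[? ?] /andP[? ?] ?; apply/andP; split; lia.
  rewrite /corner /elt /= -!expfzDr //; congr (_ ^ _).
  rewrite addrACA [RHS]addrACA -!big_split /=; congr (_ + _).
  by apply: eq_bigr => j _; rewrite /w; ring.
apply: leq_trans (subset_leq_card sub) _.
rewrite curry_imset2X; apply: leq_trans (leq_imset_card _ _) _.
rewrite cardsX leq_mul2r; apply/orP; right.
apply: leq_trans (leq_imset_card _ _) _.
by rewrite card_ffun card_bool card_ord.
Qed.

(** * Escaping a set of small doubling *)

(** The incidence argument in explicit form, for any set G with |GG| <= C|G|.
    The hypothesis 4|GG| <= q makes the average richness |P|/q at most |A|/4. *)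
Lemma succset_prodset_escape (F : finFieldType) (A G : {set F}) (C : nat) :
  0 \notin G -> (0 < #|G|)%N -> (#|prodset G| <= C * #|G|)%N ->
  (4 * #|prodset G| <= #|F|)%N -> (32 * C * #|F| < #|A| ^ 2)%N ->
  (#|A| < 2 * #|succset (prodset A) :\: G|)%N.
Proof.
move=> G0 Gpos hC hq hA; rewrite ltnNge; apply/negP => hD.
set D := succset (prodset A) :\: G in hD.
set q := #|F| in hq hA; set M := #|prodset G| in hC hq.
have q0 : (0 < q)%N by apply/card_gt0P; exists 0.
have M0 : (0 < M)%N.
  case/card_gt0P: Gpos => g gG; apply/card_gt0P; exists (g * g).
  by apply/imset2P; exists g g.
(* Zero is removed from A so that b |-> ab + 1 is injective. *)
pose A' := (A :\ (0 : F))%SET.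
pose P := finset.setX A (prodset G).
pose f (u : F * F) := (u.1 * u.2, u.1).
pose L := f @: finset.setX G A'.
have cL : #|L| = (#|G| * #|A'|)%N.
  rewrite card_in_imset ?cardsX // => -[g a] [g' a'].
  rewrite !finset.in_setX /= => /andP[gG _] _ [] /[swap] <- /mulfI -> //.
  by apply: contraNneq G0 => <-.
have rich l : l \in L -> (#|A| <= #|D| + richness F P l)%N.
  case/imsetP => -[g a]; rewrite finset.in_setX !inE /= => /and3P[gG a0 aA] ->.
  (* Split A according to whether ab + 1 is in G: the b outside inject into D,
     the b inside into the points of P on the line. *)
  rewrite -(cardsID [set b | a * b + 1 \in G]%SET A) addnC; apply: leq_add.
    rewrite -(card_imset _ (mulfI a0)) -(card_imset _ (addIr 1)).
    apply: subset_leq_card; apply/fintype.subsetP => z /imsetP[y /imsetP[b]].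
    rewrite !inE => /andP[nG bA] -> ->; rewrite nG.
    by apply/imsetP; exists (a * b) => //; apply/imset2P; exists a b.
  pose h b := (b, g * (a * b + 1)).
  have hinj : injective h by move=> b b' [].
  rewrite -(card_imset _ hinj); apply: subset_leq_card.
  apply/fintype.subsetP => z /imsetP[b]; rewrite !inE => /andP[bA bG] ->.
  rewrite /= bA /incident /= mulrDr mulr1 mulrA eqxx andbT -mulrA -[X in _ + X]mulr1 -mulrDr.
  by apply/imset2P; exists g (a * b + 1).
have cP : #|P| = (#|A| * M)%N by rewrite cardsX.
have A2 : (2 <= #|A|)%N.
  have C0 : (0 < C)%N by case: (C) hC; [lia | ].
  by rewrite ltnNge; apply/negP => A1; move: hA; nia.
have A0 : (#|A| <= 2 * #|A'|)%N.
  move: (cardsD1 0 A) A2; rewrite -/A' => ->.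
  by case: (0 \in A) => /=; move: #|A'| => k; clear; lia.
have := @rich_lines_bound rat F P L (#|A|%:R / 4).
rewrite -/q cP cL.
have hrat : (#|A| * M)%:R / q%:R <= #|A|%:R / 4 :> rat.
  rewrite ler_pdivrMr ?ltr0n // mulrAC ler_pdivlMr // -!natrM ler_nat; nia.
(* Each line has at least |A|/2 points and the average is at most |A|/4, which
   leaves an excess of at least |A|/4. *)
have hyp l : l \in L -> (#|A| * M)%:R / q%:R + #|A|%:R / 4 <= (richness F P l)%:R :> rat.
  move/rich => hl; have : (#|A| <= 2 * richness F P l)%N by lia.
  rewrite -(ler_nat rat) natrM; lra.
move=> /(_ _ hyp) H.
have {}H : (#|G| * #|A'|)%:R * (#|A|%:R / 4) ^+ 2 <= q%:R * (#|A| * M)%:R :> rat.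
  by apply: H; rewrite divr_ge0.
have {H} : (#|G| * #|A'| * #|A| ^ 2 <= 16 * (q * (#|A| * M)))%N.
  by rewrite -(ler_nat rat) -mulnn !natrM; move: H; rewrite !natrM; lra.
move=> H.
have H1 : (#|G| * #|A| * #|A| ^ 2 <= 32 * (q * (#|A| * (C * #|G|))))%N.
  apply: (@leq_trans (2 * (#|G| * #|A'| * #|A| ^ 2))); first nia.
  apply: (@leq_trans (32 * (q * (#|A| * M)))); first lia.
  by rewrite !leq_mul2l hC !orbT.
have : (#|G| * #|A| * #|A| ^ 2 <= #|G| * #|A| * (32 * C * q))%N by nia.
rewrite leq_pmul2l; first lia.
by rewrite muln_gt0 Gpos; lia.
Qed.

(** * The choice of constants *)

Theorem theorem1p6 (R : realType) (eps delta : R) (d : nat) (K : R)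
    (heps : 0 < eps) (hdelta : 0 < delta) (hd : (1 <= d)%N) (hK : 1 <= K) :
  exists (c : R) (q0 : nat), 0 < c /\
    forall (F : finFieldType) (A G : {set F}),
      (q0 <= #|F|)%N ->
      K^-1 * #|F|%:R `^ (3 / 2 + eps) <= #|A|%:R * #|prodset A|%:R ->
      #|prodset A|%:R <= K * #|F|%:R `^ (1 - delta) ->
      is_geom_prog d G ->
      K^-1 * #|prodset A|%:R <= #|G|%:R ->
      #|G|%:R <= K * #|prodset A|%:R ->
      c * #|F|%:R `^ delta <= #|succset (prodset A) :\: G|%:R.
Proof.
(* m absorbs the constants of both size conditions of the incidence argument;
   q0 is chosen so that q^delta >= m as soon as q >= q0. *)
pose m : R := 33 * (2 ^ d)%:R * K ^+ 4.
exists (2 * K ^+ 2)^-1, (Num.truncn (m `^ delta^-1)).+1.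
have K0 : 0 < K by lra.
have d1 : 1 <= (2 ^ d)%:R :> R by rewrite ler1n expn_gt0.
split; first by rewrite invr_gt0 mulr_gt0 // exprn_gt0.
move=> F A G hq hA hAA hG _ hGA.
set q : R := #|F|%:R in hA hAA *; set a : R := #|A|%:R in hA.
set n : R := #|prodset A|%:R in hA hAA hGA.
have q1 : 1 <= q by rewrite ler1n; apply/card_gt0P; exists 0.
have q0 : 0 < q by lra.
set w := q `^ delta.
have w0 : 0 < w by rewrite powR_gt0.
have K4 : K ^+ 2 <= K ^+ 4 by rewrite ler_weXn2l.
have K41 : 1 <= K ^+ 4 by rewrite exprn_ege1.
have m0 : 0 <= m by rewrite /m mulr_ge0 //; lra.
have hw : m <= w.
  rewrite -[m]powRr1 // -[X in m `^ X](mulVf (lt0r_neq0 hdelta)) powRrM.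
  apply: ge0_ler_powR; rewrite ?nnegrE ?powR_ge0 //; try lra.
  apply: ltW; apply: lt_le_trans (truncnS_gt _) _.
  by rewrite ler_nat.
have e1 : q `^ (1 - delta) = q / w.
  by rewrite powRD ?(gt_eqF q0) ?implybT // powRr1 ?powRN //; lra.
set s := q `^ (2^-1).
have s2 : s ^+ 2 = q by rewrite /s -powR_mulrn ?powR_ge0 // -powRrM mulVf // powRr1 // ltW.
have s1 : 1 <= s by rewrite -(powRr0 q) ler_powR // invr_ge0.
set u := q `^ eps.
have u1 : 1 <= u by rewrite -(powRr0 q) ler_powR // ltW.
have e2 : q `^ (3 / 2 + eps) = q * s * u.
  rewrite -[q in q * s]powRr1; last by lra.
  rewrite /s /u -!powRD ?(gt_eqF q0) ?implybT //; congr (_ `^ _); lra.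
have K2 : 0 < K ^+ 2 by rewrite exprn_gt0.
(* q^(1/2 + delta) <= K^2 |A|, from the two hypotheses on |AA|; the factor
   q^eps >= 1 is discarded. *)
have ha : s * w <= a * K ^+ 2.
  have : K^-1 * (q * s * u) <= a * (K * (q / w)).
    by rewrite -e2 -e1; apply: le_trans hA _; rewrite ler_wpM2l.
  rewrite ler_pdivrMl // => h.
  have {}h : q * (s * u) <= q * (a * K ^+ 2 / w).
    by apply: le_trans (le_trans _ h) _; rewrite le_eqVlt; apply/orP; left; apply/eqP; ring.
  move: h; rewrite ler_pM2l // ler_pdivlMr // => h; apply: le_trans h.
  by rewrite ler_pM2r // ler_peMr //; lra.
have [G0 Gpos GG] := geom_prog_small_doubling F d G hG.
have hGG : (4 * #|prodset G| <= #|F|)%N.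
  move: GG; rewrite -!(ler_nat R) !natrM -/q => GG.
  have : #|G|%:R <= K * (K * (q / w)).
    by apply: le_trans hGA _; rewrite ler_pM2l // -e1.
  have -> : K * (K * (q / w)) = K ^+ 2 * q / w by ring.
  rewrite ler_pdivlMr // => h.
  have h1 : (2 ^ d)%:R * (#|G|%:R * w) <= (2 ^ d)%:R * (K ^+ 2 * q) by rewrite ler_wpM2l.
  have h2 : #|prodset G|%:R * w <= (2 ^ d)%:R * #|G|%:R * w by rewrite ler_pM2r.
  have h3 : 4 * (2 ^ d)%:R * K ^+ 2 <= w.
    apply: le_trans hw; rewrite /m ler_pM //; lra.
  have h4 : 4 * (2 ^ d)%:R * K ^+ 2 * q <= w * q by rewrite ler_pM2r.
  rewrite -(ler_pM2r w0); lra.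
have hAq : (32 * 2 ^ d * #|F| < #|A| ^ 2)%N.
  rewrite -(ltr_nat R) natrX !natrM -/q -/a.
  have sw : (s * w) ^+ 2 <= (a * K ^+ 2) ^+ 2.
    by rewrite ler_sqr // nnegrE ?mulr_ge0 //; lra.
  have w1 : w <= w ^+ 2.
    rewrite expr2 ler_peMr //; first lra.
    by apply: le_trans hw; rewrite /m -[leLHS]mul1r ler_pM //; lra.
  have h1 : q * m <= q * w ^+ 2 by rewrite ler_pM2l //; lra.
  have K40 : 0 < K ^+ 4 by rewrite exprn_gt0.
  rewrite -(ltr_pM2r K40).
  have h2 : q * w ^+ 2 <= a ^+ 2 * K ^+ 4.
    have -> : a ^+ 2 * K ^+ 4 = (a * K ^+ 2) ^+ 2 by ring.
    by rewrite -s2 -exprMn.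
  have h3 : 0 < (2 ^ d)%:R * q * K ^+ 4 by rewrite !mulr_gt0 //; lra.
  move: h1; rewrite /m; lra.
have := succset_prodset_escape F A G (2 ^ d) G0 Gpos GG hGG hAq.
rewrite -(ltr_nat R) natrM -/a => hD.
rewrite ler_pdivrMl ?mulr_gt0 //.
have : w <= s * w by rewrite ler_peMl //; lra.
have : K ^+ 2 * a <= K ^+ 2 * (2 * #|succset (prodset A) :\: G|%:R) by rewrite ler_wpM2l ?ltW.
lra.
Qed.
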